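(* Let $S$ be a real symmetric positive definite $N\times N$ matrix, let $V(x)=\frac12x^TSx$ on $\mathbb{R}^N$, and let $b(x)=-Ax$ where $A$ is a real $N\times N$ matrix. Then $$\nabla\cdot\left(b\,e^{-V}\right)=0\quad\text{on }\mathbb{R}^N$$ if and only if $A=JS$ for some real matrix $J$ with $J=-J^T$. *)

(* Defs.v *)
From HB Require Import structures.
From mathcomp Require Export all_boot all_order all_algebra.
From mathcomp Require Export all_classical all_reals all_analysis.
Set Implicit Arguments.
Unset Strict Implicit.
Unset Printing Implicit Defensive.
Import Order.TTheory GRing.Theory Num.Theory.
Import numFieldNormedType.Exports.
Local Open Scope ring_scope.

(* S is assumed symmetric separately. The product is 1 x 1, hence the [0 0]. *)
Definition positive_definite (R : realType) (N : nat) (S : 'M[R]_N) : Prop :=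
  forall x : 'cV[R]_N, x != 0 -> 0 < (x^T *m S *m x) 0 0.

(* R^N is 'cV[R]_N. 'D_v f x is a total operator: the value is the usual divergence where the
   partial derivatives d F_i / d x_i exist. *)
Definition divergence (R : realType) (N : nat) (F : 'cV[R]_N -> 'cV[R]_N)
    (x : 'cV[R]_N) : R :=
  \sum_(i < N) 'D_(delta_mx i 0) (fun y : 'cV[R]_N => F y i 0) x.

(* Main.v *)
(* The divergence at x equals exp(-V(x)) (x^T S A x - tr A). It vanishes for every x iff tr A = 0
   and S A is antisymmetric. The latter holds iff A S^-1 = S^-1 (S A) S^-1 is antisymmetric, and
   it implies tr A = 0. *)
Require Import Defs.
From mathcomp Require Import ring lra.
Import Order.TTheory GRing.Theory Num.Theory.
Import numFieldNormedType.Exports.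
Local Open Scope ring_scope.

(** Both sides are limits of the same difference quotient. This turns a partial derivative on
    ['cV[R]_N] into a derivative in one real variable, where the usual differentiation rules
    apply. *)
Lemma derive_line (R : realType) (U : normedModType R) (f : U -> R) (v x : U) :
  'D_v f x = 'D_1 (fun h : R => f (h *: v + x)) 0.
Proof.
rewrite /derive /=.
suff -> : (fun h : R => h^-1 *: (f (h *: v + x) - f x))
  = (fun h : R => h^-1 *: (f ((h * 1 + 0) *: v + x) - f (0 *: v + x))) by [].
by apply/funext => h; rewrite scale0r add0r addr0 mulr1.
Qed.

(** Along the line [h *: v + x], the potential is [a + h * s + h ^+ 2 * c] and a component of
    [A *m y] is [p + h * q]. The product rule at [h = 0] kills the contribution of [c]. *)
Lemma derive_expR_quadratic (R : realType) (a s c p q : R) :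
  'D_1 (fun h : R => expR (- (a + h * s + h ^+ 2 * c)) * - (p + h * q)) 0
  = expR (- a) * (s * p - q).
Proof.
have D : is_derive (0 : R) (1 : R)
  (fun h : R => expR (- (a + h * s + h ^+ 2 * c)) * - (p + h * q))
  (expR (- a) * (s * p - q)).
  apply: is_derive_eq.
  rewrite /GRing.scale /= !(mul0r, expr0n, addr0) /=.
  ring.
exact: derive_val.
Qed.

Lemma quadratic_form_line (R : realType) (N : nat) (S : 'M[R]_N)
    (x v : 'cV[R]_N) (h : R) : S^T = S ->
  ((h *: v + x)^T *m S *m (h *: v + x)) 0 0
  = (x^T *m S *m x) 0 0 + 2 * h * (v^T *m S *m x) 0 0
    + h ^+ 2 * (v^T *m S *m v) 0 0.
Proof.
move=> S_sym.
have sym : (x^T *m S *m v) 0 0 = (v^T *m S *m x) 0 0.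
  have -> : v^T *m S *m x = (x^T *m S *m v)^T.
    by rewrite !trmx_mul trmxK S_sym mulmxA.
  by rewrite [RHS]mxE.
rewrite [(_ + _)^T]linearD /= [(_ *: _)^T]linearZ /=.
rewrite !mulmxDl !mulmxDr -!scalemxAl -!scalemxAr.
have mxD (a b : 'M[R]_1) : (a + b) 0 0 = a 0 0 + b 0 0 by rewrite mxE.
have mxZ c (a : 'M[R]_1) : (c *: a) 0 0 = c * a 0 0 by rewrite mxE.
rewrite !(mxD, mxZ) sym; ring.
Qed.

(** By the product rule the [i]-th partial derivative is exp(-V(x)) ((Sx)_i (Ax)_i - A_ii), because
    symmetry of [S] makes Sx the gradient of V. *)
Lemma divergence_gauss (R : realType) (N : nat) (S A : 'M[R]_N)
    (x : 'cV[R]_N) : S^T = S ->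
  divergence (fun y => expR (- (2^-1 * (y^T *m S *m y) 0 0)) *: - (A *m y)) x
  = expR (- (2^-1 * (x^T *m S *m x) 0 0))
    * ((x^T *m (S *m A) *m x) 0 0 - \tr A).
Proof.
move=> S_sym; rewrite /divergence.
have -> : (x^T *m (S *m A) *m x) 0 0 = \sum_i (S *m x) i 0 * (A *m x) i 0.
  rewrite mulmxA -mulmxA -[in x^T *m S]S_sym -trmx_mul mxE.
  by apply: eq_bigr => i _; rewrite mxE.
rewrite /mxtrace -sumrB mulr_sumr; apply: eq_bigr => i _.
(* The value of the derivative does not determine the coefficient of [h ^+ 2], so it is supplied: it
   is V(e_i) = S_ii / 2. *)
rewrite derive_line -(derive_expR_quadratic _ _ _ (2^-1 * S i i)).
congr (derive _ _ _); apply/funext => h.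
have row (B : 'M[R]_N) (y : 'cV_N) :
    ((delta_mx i 0 : 'cV_N)^T *m B *m y) 0 0 = (B *m y) i 0.
  by rewrite trmx_delta -rowE -row_mul mxE.
have diag (B : 'M[R]_N) : (B *m delta_mx i 0 : 'cV_N) i 0 = B i i.
  by rewrite -colE mxE.
rewrite quadratic_form_line // !row diag [LHS]mxE; congr (expR _ * _).
  by field.
rewrite mxE mulmxDr -scalemxAr; congr (- _).
by rewrite [LHS]mxE [X in X + _]mxE diag addrC.
Qed.

(** Polarization: the values at e_i, e_j and e_i + e_j leave M_ij + M_ji = 0. Conversely, a 1 x 1
    matrix is its own transpose, so the form of an antisymmetric [M] equals its own negative. *)
Lemma quadratic_form_eq0_antisym (R : realType) (N : nat) (M : 'M[R]_N) :
  (forall x : 'cV[R]_N, (x^T *m M *m x) 0 0 = 0) <-> M^T = - M.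
Proof.
split=> [M0 | M_anti x].
  have entry i j : ((delta_mx i 0 : 'cV[R]_N)^T *m M *m (delta_mx j 0 : 'cV_N)) 0 0
      = M i j.
    by rewrite trmx_delta -rowE -colE !mxE.
  apply/matrixP => i j; rewrite !mxE; apply/eqP; rewrite -addr_eq0; apply/eqP.
  have := M0 (delta_mx i 0 + delta_mx j 0).
  rewrite [(_ + _)^T]linearD /= !mulmxDl !mulmxDr.
  rewrite [LHS]mxE [X in X + _ = _]mxE [X in _ + X = _]mxE !entry.
  have := M0 (delta_mx i 0); have := M0 (delta_mx j 0); rewrite !entry.
  by move=> -> ->; rewrite add0r addr0 addrC.
have : (x^T *m M *m x) 0 0 = - (x^T *m M *m x) 0 0.
  have tr1 (B : 'M[R]_1) : B 0 0 = B^T 0 0 by rewrite mxE.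
  rewrite {1}tr1 !trmx_mul trmxK M_anti mulNmx mulmxN mulmxA.
  by rewrite mxE.
lra.
Qed.

(** A row [u] of the kernel of [S^T] satisfies [S *m u^T = 0], so the form vanishes at [u^T], which
    forces [u = 0]. *)
Lemma positive_definite_unitmx (R : realType) (N : nat) (S : 'M[R]_N) :
  positive_definite S -> S \in unitmx.
Proof.
move=> S_pos; rewrite -unitmx_tr -row_free_unit -kermx_eq0; apply/eqP/row_matrixP => i.
rewrite row0; set u := row i _.
have uS : u *m S^T = 0 by rewrite -row_mul mulmx_ker row0.
apply/eqP; apply: contraT => u0.
have /S_pos : u^T != 0.
  by apply: contra u0 => /eqP u0; rewrite -[u]trmxK u0 trmx0.
by rewrite -mulmxA -[S *m _]trmxK trmx_mul trmxK uS trmx0 mulmx0 mxE ltxx.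
Qed.

Theorem lemma1 (R : realType) (N : nat) (S A : 'M[R]_N)
    (S_sym : S^T = S) (S_pos : positive_definite S) :
  let V := fun x : 'cV[R]_N => 2^-1 * (x^T *m S *m x) 0 0 in
  let b := fun x : 'cV[R]_N => - (A *m x) in
  (forall x : 'cV[R]_N, divergence (fun y => expR (- V y) *: b y) x = 0) <->
  (exists J : 'M[R]_N, J = - J^T /\ A = J *m S).
Proof.
move=> V b.
have S_unit := positive_definite_unitmx _ _ _ S_pos.
split=> [div0 | [J [J_anti AJ]] x]; last first.
  have SA_anti : (S *m A)^T = - (S *m A).
    by rewrite AJ !trmx_mul S_sym [in RHS]J_anti mulNmx mulmxN opprK mulmxA.
  have trA : \tr A = 0.
    (* Transposition and cyclicity of the trace give tr(JS) = tr(S J^T) = tr(J^T S) = - tr(JS). *)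
    have : \tr A = - \tr A.
      by rewrite {1}AJ -mxtrace_tr trmx_mul S_sym mxtrace_mulC AJ [in RHS]J_anti
        mulNmx raddfN opprK.
    lra.
  rewrite divergence_gauss //.
  by rewrite ((quadratic_form_eq0_antisym _ _ _).2 SA_anti x) trA subr0 mulr0.
have form_eq (x : 'cV_N) : (x^T *m (S *m A) *m x) 0 0 = \tr A.
  have := div0 x; rewrite divergence_gauss // => /eqP.
  by rewrite mulf_eq0 gt_eqF ?expR_gt0 //= subr_eq0 => /eqP.
(* The form is constant, equal to tr A, and it vanishes at the origin. *)
have trA : \tr A = 0 by rewrite -(form_eq 0) mulmx0 mxE.
have SA_anti : (S *m A)^T = - (S *m A).
  by apply/quadratic_form_eq0_antisym => x; rewrite form_eq.
exists (A *m invmx S); split; last by rewrite mulmxKV.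
have -> : A *m invmx S = invmx S *m (S *m A) *m invmx S by rewrite mulKmx.
rewrite [in RHS]trmx_mul [(invmx S *m _)^T]trmx_mul SA_anti trmx_inv S_sym.
by rewrite mulNmx mulmxN opprK -mulmxA.
Qed.
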